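(* Let $S$ be an arbitrary set, let $\Sigma$ be a $\sigma$-algebra over $S$, and let $\mathrm{M}$ be the set of all nonnegative real-valued (hence finite) measures on $\Sigma$. Let $k\ge1$ be an integer, let $f_1,\dots,f_k\colon S\to\mathbb{R}$ be $\Sigma$-measurable functions, $\mathbf{f}=(f_1,\dots,f_k)$, and let $C\subseteq\mathbb{R}^k$ be any set. Let $\Lambda\subseteq\mathrm{M}$ be a convex cone such that $\mu_A\in\Lambda$ for all $\mu\in\Lambda$ and $A\in\Sigma$. Let $g\colon S\to\mathbb{R}$ be a $\Sigma$-measurable function such that the integral $\int_S g\,d\mu$ exists in $[-\infty,\infty]$ for each $\mu\in\Lambda_{\mathbf{f},C}$. Suppose that $$\sup\Big\{\int_S g\,d\mu\colon\mu\in\Lambda_{\mathbf{f},C}\Big\}=\sup\Big\{\int_S g\,d\mu\colon\mu\in\operatorname{ex}\Lambda_{\mathbf{f},C}\Big\}.$$ Then $$\sup\Big\{\int_S g\,d\mu\colon\mu\in\Lambda_{\mathbf{f},C}\Big\}\le\sup\Big\{\int_S g\,d\mu\colon\mu\in\Delta_{\mathbf{f}}^{(k)}\cap\mathrm{M}_{\mathbf{f},C}\Big\}.$$ If, in addition, $\Delta_{\mathbf{f}}^{(k)}\subseteq\Lambda$, then $$\sup\Big\{\int_S g\,d\mu\colon\mu\in\Lambda_{\mathbf{f},C}\Big\}=\sup\Big\{\int_S g\,d\mu\colon\mu\in\Delta_{\mathbf{f}}^{(k)}\cap\Lambda_{\mathbf{f},C}\Big\}.$$ Moreover, in the inequality one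 can replace $\Delta_{\mathbf{f}}^{(k)}$ by $\Delta^{(k)}$; one can do so in the last equality too if such a replacement is made in the additional condition as well (that is, if $\Delta^{(k)}\subseteq\Lambda$ is assumed).
   Context: Suprema are taken in $[-\infty,\infty]$. For $\mu\in\mathrm{M}$ and $A\in\Sigma$, the truncation $\mu_A\in\mathrm{M}$ is defined by $\mu_A(B)=\mu(A\cap B)$ for $B\in\Sigma$. One writes $\mathbf{f}\in L^1(\mu)$ if every $f_j$ is $\mu$-integrable, and $\int_S\mathbf{f}\,d\mu=(\int_S f_1\,d\mu,\dots,\int_S f_k\,d\mu)$. The moment sets are $\mathrm{M}_{\mathbf{f},C}=\{\mu\in\mathrm{M}\colon \mathbf{f}\in L^1(\mu),\ \int_S\mathbf{f}\,d\mu\in C\}$ and $\Lambda_{\mathbf{f},C}=\Lambda\cap\mathrm{M}_{\mathbf{f},C}$. For a (not necessarily convex) set $\mathrm{K}\subseteq\mathrm{M}$, $\operatorname{ex}\mathrm{K}$ is the set of all extreme points of $\mathrm{K}$: $\mu\in\operatorname{ex}\mathrm{K}$ iff $\mu\in\mathrm{K}$ and for any $t\in(0,1)$ and $\nu_0,\nu_1\in\mathrm{K}$ with $(1-t)\nu_0+t\nu_1=\mu$ one has $\nu_0=\nu_1$. For $s\in S$, $\delta_s$ is the Dirac probability measure on $\Sigma$: $\delta_s(A)=1$ if $s\in A$ and $\delta_s(A)=0$ otherwise. The set $\Delta_{\mathbf{f}}^{(k)}$ consists of all measures $\sum_{i=1}^m a_i\delta_{s_i}$ with $m\in\{0,1,\dots,k\}$,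 $(a_1,\dots,a_m)\in(0,\infty)^m$, $(s_1,\dots,s_m)\in S^m$ such that the vectors $\mathbf{f}(s_1),\dots,\mathbf{f}(s_m)$ are linearly independent; for $m=0$ the sum is the zero measure and the conditions are regarded as trivially satisfied, so $0\in\Delta_{\mathbf{f}}^{(k)}$. The set $\Delta^{(k)}$ consists of all measures $\sum_{i=1}^k a_i\delta_{s_i}$ with $(a_1,\dots,a_k)\in[0,\infty)^k$ and $(s_1,\dots,s_k)\in S^k$.
   Formalization: The set S is taken to be nonempty; for empty S the ''Moreover'' part fails as written (with Λ = {0} and 0 in C, the set Δ^(k) is empty and the inequality would read 0 ≤ −∞). *)

(* Defs.v *)
(* MathComp-Analysis. *)
From mathcomp Require Export all_boot all_order all_algebra.
From mathcomp Require Export all_classical all_reals all_analysis.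
From mathcomp Require Import lra.

Set Implicit Arguments.
Unset Strict Implicit.
Unset Printing Implicit Defensive.

Import Order.TTheory GRing.Theory Num.Theory.
Import numFieldNormedType.Exports.

Local Open Scope classical_set_scope.
Local Open Scope ring_scope.
Local Open Scope ereal_scope.

Section MomentSets.
Context {d : measure_display} {S : measurableType d} {R : realType}.
Local Notation M := {finite_measure set S -> \bar R}.

(* [S] is pointed, hence nonempty.  For S empty, 0 is the only measure: it lies
   in [Delta_f f], but [Delta k] with 0 < k is empty, so that the claims about
   [Delta k] would fail. *)

(* A library measure is a function on all of [set S], constrained only on
   measurable sets.  Two of them are the same measure on the sigma-algebra iff
   they satisfy [same_measure]; every equality between measures below is this
   one rather than Leibniz equality. *)
Definition same_measure (mu nu : M) : Prop :=
  forall A, measurable A -> mu A = nu A.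

(* [rho] ranges over all representatives of a mu + b nu; in particular, such an
   [L] is invariant under [same_measure] (see [convex_cone_same] below). *)
Definition convex_cone (L : set M) : Prop :=
  forall (mu nu rho : M) (a b : R),
    (0 < a)%R -> (0 < b)%R -> L mu -> L nu ->
    (forall A, measurable A -> rho A = a%:E * mu A + b%:E * nu A) ->
    L rho.

Lemma convex_cone_same (L : set M) (mu nu : M) :
  convex_cone L -> same_measure mu nu -> L mu -> L nu.
Proof.
move=> Lc mn Lmu; apply: (Lc mu mu nu (2^-1)%R (2^-1)%R) => // A mA.
rewrite -(mn A mA) -(fineK (fin_num_measure mu A mA)) -!EFinM -EFinD.
by congr EFin; lra.
Qed.

Definition truncation_closed (L : set M) : Prop :=
  forall (mu rho : M) (A : set S),
    L mu -> measurable A ->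
    (forall B, measurable B -> rho B = mu (A `&` B)) ->
    L rho.

Definition extreme_points (K : set M) : set M :=
  [set mu : M | K mu /\
    forall (t : R) (nu0 nu1 : M),
      (0 < t < 1)%R -> K nu0 -> K nu1 ->
      (forall A, measurable A -> (1 - t)%:E * nu0 A + t%:E * nu1 A = mu A) ->
      same_measure nu0 nu1].

Definition moment_set (k : nat) (f : 'I_k -> S -> R) (C : set 'rV[R]_k) :
    set M :=
  [set mu : M | (forall j, mu.-integrable setT (EFin \o f j)) /\
                C (\row_j (\int[mu]_x f j x)%R)].

(* For m = 0 the family is empty, hence free, and the measure is zero. *)
Definition Delta_f (k : nat) (f : 'I_k -> S -> R) : set M :=
  [set mu : M | exists (m : nat) (a : 'I_m -> R) (s : 'I_m -> S),
    [/\ (m <= k)%N,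
        (forall i, 0 < a i)%R,
        free [tuple (\row_j f j (s i))%R | i < m] &
        forall A, measurable A -> mu A = \sum_(i < m) (a i)%:E * \d_(s i) A]].

Definition Delta (k : nat) : set M :=
  [set mu : M | exists (a : 'I_k -> R) (s : 'I_k -> S),
    (forall i, 0 <= a i)%R /\
    forall A, measurable A -> mu A = \sum_(i < k) (a i)%:E * \d_(s i) A].

(* The library integral is total, with oo - oo = -oo, so existence has to be
   stated separately. *)
Definition integral_exists (mu : M) (g : S -> R) : Prop :=
  \int[mu]_x (EFin \o g)^\+ x < +oo \/ \int[mu]_x (EFin \o g)^\- x < +oo.

Definition sup_integral (g : S -> R) (K : set M) : \bar R :=
  ereal_sup [set \int[mu]_x (g x)%:E | mu in K].

End MomentSets.

(* Main.v *)
(* Let mu be an extreme point.  If A_1, ..., A_m are disjoint sets of positive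
   mu-measure, then the vectors int_{A_i} f dmu are linearly independent, since
   a linear relation would yield a perturbation of mu with the same moments; hence
   m <= k.  If m is maximal, then the A_i are atoms of mu which carry all of its
   mass.  On an atom every measurable function is almost everywhere constant, so
   for suitable points s_i the measure sum_i mu(A_i) delta_{s_i} integrates all
   f_j and g exactly as mu does, and it belongs to Delta_f. *)
Require Import Defs.
From mathcomp Require Import measurable_realfun.
From mathcomp Require Import ring lra.

Set Implicit Arguments.
Unset Strict Implicit.
Unset Printing Implicit Defensive.

Import Order.TTheory GRing.Theory Num.Theory.

Local Open Scope classical_set_scope.
Local Open Scope ring_scope.
Local Open Scope ereal_scope.

(** * Finite nonnegative combinations of measures *)

Section Combinations.
Context {d : measure_display} {S : measurableType d} {R : realType}.
Local Notation M := {finite_measure set S -> \bar R}.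

(** A relation rather than an operation: it constrains [rho] on measurable sets only, so that a
    given measure such as [mu] can be recognised as a combination of its own truncations. *)
Definition is_comb I (r : seq I) (b : I -> R) (m : I -> M) (rho : M) :=
  forall A, measurable A -> rho A = \sum_(i <- r) (b i)%:E * m i A.

Variables (I : Type) (b : I -> R) (m : I -> M).
Hypothesis b_ge0 : forall i, (0 <= b i)%R.
Implicit Types (r : seq I) (rho : M).

Lemma comb_exists r : exists rho, is_comb r b m rho.
Proof.
elim: r => [|i r [rho rhoE]].
  by exists (mzero : M) => A mA; rewrite big_nil.
pose nu := measure_add (mscale (NngNum (b_ge0 i)) (m i)) rho.
have nuE A : nu A = (b i)%:E * m i A + rho A := measure_addE _ _ A.
have nu_fin : nu setT < +oo.
  by rewrite ltey_eq nuE fin_numD fin_numM ?fin_num_measure.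
(* Restriction to the whole space changes no value; it packages [nu] as a finite measure. *)
exists (mfrestr measurableT nu_fin : M) => A mA.
rewrite big_cons -rhoE// -nuE.
by rewrite -[A in RHS]setIT.
Qed.

(** [convex_cone] admits only positive coefficients, so vanishing terms are dropped, and the zero
    measure of the empty sum is obtained by truncating a member of [L] to the empty set. *)
Lemma convex_cone_comb (L : set M) r rho :
  convex_cone L -> truncation_closed L -> L !=set0 ->
  (forall i, L (m i)) -> is_comb r b m rho -> L rho.
Proof.
move=> Lc Lt [mu Lmu] Lm; elim: r rho => [|i r IHr] rho rhoE.
  by apply: (Lt mu rho set0) => // A mA; rewrite rhoE// big_nil set0I measure0.
have [nu nuE] := comb_exists r.
have [bi0|bi0] := eqVneq (b i) 0%R.
  by apply: IHr => A mA; rewrite rhoE// big_cons bi0 mul0e add0e.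
apply: (Lc (m i) nu rho (b i) 1%R) => //.
- by rewrite lt_def bi0 b_ge0.
- exact: IHr nuE.
- by move=> A mA; rewrite rhoE// nuE// big_cons mul1e.
Qed.

Lemma comb_fine r rho A : is_comb r b m rho -> measurable A ->
  rho A = (\sum_(i <- r) b i * fine (m i A))%R%:E.
Proof.
move=> rhoE mA; rewrite rhoE// -sumEFin; apply: eq_bigr => i _.
by rewrite EFinM fineK// fin_num_measure.
Qed.

Lemma ge0_integral_comb r rho (h : S -> \bar R) :
  measurable_fun setT h -> (forall x, 0 <= h x) -> is_comb r b m rho ->
  \int[rho]_x h x = \sum_(i <- r) (b i)%:E * \int[m i]_x h x.
Proof.
move=> mh h0; elim: r rho => [|i r IHr] rho rhoE.
  rewrite (eq_measure_integral (mzero : M)) => [|A mA _].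
    by rewrite integral_measure_zero big_nil.
  by apply: (eq_trans (rhoE A mA)); rewrite big_nil.
have [nu nuE] := comb_exists r.
rewrite (eq_measure_integral
  (measure_add (mscale (NngNum (b_ge0 i)) (m i)) nu)) => [|A mA _]; last first.
  rewrite [RHS](_ : _ = (b i)%:E * m i A + nu A); last exact: measure_addE.
  by rewrite nuE//; apply: (eq_trans (rhoE A mA)); rewrite big_cons.
rewrite ge0_integral_measure_add// ge0_integral_mscale//.
by rewrite big_cons (IHr nu nuE).
Qed.

(** The positive and negative parts are treated by [ge0_integral_comb]; integrability makes all
    their integrals finite, so the difference of the two sums can be taken in [R]. *)
Lemma integral_comb r rho (f : S -> R) :
  measurable_fun setT f -> (forall i, (m i).-integrable setT (EFin \o f)) ->
  is_comb r b m rho ->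
  rho.-integrable setT (EFin \o f) /\
  \int[rho]_x (f x)%:E =
    (\sum_(i <- r) b i * \int[m i]_x f x)%R%:E.
Proof.
move=> mf fi rhoE; have mEf : measurable_fun setT (EFin \o f).
  exact/measurable_EFinP.
have posE i : \int[m i]_x (EFin \o f)^\+ x \is a fin_num.
  exact: (integrable_pos_fin_num measurableT (fi i)).
have negE i : \int[m i]_x (EFin \o f)^\- x \is a fin_num.
  exact: (integrable_neg_fin_num measurableT (fi i)).
split.
  apply/integrableP; split => //.
  rewrite (ge0_integral_comb _ _ rhoE)//; last exact: measurableT_comp.
  apply: lte_sum_pinfty => i _; apply: lte_mul_pinfty; rewrite ?lee_fin//.
  by have /integrableP[] := fi i.
have fE (nu : M) : \int[nu]_x (f x)%:E =
    \int[nu]_x (EFin \o f)^\+ x - \int[nu]_x (EFin \o f)^\- x.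
  exact: integralE.
rewrite fE (ge0_integral_comb _ _ rhoE)//; last exact: measurable_funepos.
rewrite (ge0_integral_comb _ _ rhoE)//; last exact: measurable_funeneg.
under eq_bigr do rewrite -(fineK (posE _)) -EFinM.
under [X in _ - X]eq_bigr do rewrite -(fineK (negE _)) -EFinM.
rewrite !sumEFin -EFinB -sumrB; congr EFin; apply: eq_bigr => i _.
rewrite -mulrBr; congr (_ * _)%R.
by rewrite /Rintegral fE [RHS]fineB ?posE ?negE.
Qed.

End Combinations.

(** * Almost everywhere constant functions on an atom *)

Section ZeroOneMeasure.
Context {d : measure_display} {S : measurableType d} {R : realType}.
Variable mu : {finite_measure set S -> \bar R}.

(** One point [s] must serve the whole family, because a single Dirac mass will replace the atom for
    all [f j] and [g] at once. Countability leaves only countably many null sets to avoid. *)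
Lemma zero_one_ae_cst (I : countType) (h : I -> S -> R) :
  (forall i, measurable_fun setT (h i)) ->
  (forall B, measurable B -> mu B = 0 \/ mu (~` B) = 0) ->
  0 < mu setT ->
  exists s, forall i, {ae mu, forall x, h i x = h i s}.
Proof.
move=> mh mu01 mu_gt0.
pose U (p : I * rat) := h p.1 @^-1` `]-oo, ratr p.2].
have mU p : measurable (U p).
  by rewrite -[U p]setTI; apply: mh.
(* Two points outside the null sets [N p] lie on the same side of every
   rational cut, so every [h i] takes the same value at both. *)
pose N p := if mu (U p) == 0 then U p else ~` U p.
have muN p : mu (N p) = 0 /\ measurable (N p).
  rewrite /N; case: eqP => [//|/eqP Up0]; split; last exact: measurableC.
  by have [/eqP|//] := mu01 _ (mU p); rewrite (negPf Up0).
pose avoid (x : S) := forall p, ~ N p x.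
have ae_avoid : {ae mu, forall x, avoid x}.
  (* [ae_foralln] is about sequences, so the indices [p] are coded by natural numbers; a number that
     codes no index imposes no condition. *)
  have : {ae mu, forall x n,
      if unpickle n is Some p then ~ N p x else True}.
    apply: ae_foralln => n; case: (unpickle n) => [p|]; last exact: aeW.
    have [muN0 mN] := muN p.
    by exists (N p); split => // x /= /contrapT.
  by apply: filterS => x Nx p; have := Nx (pickle p); rewrite pickleK.
have le_avoid i x y : avoid x -> avoid y -> (h i y <= h i x)%R.
  move=> ax ay; rewrite leNgt; apply/negP => /rat_in_itvoo[q].
  rewrite in_itv/= => /andP[xq qy].
  move: (ax (i, q)) (ay (i, q)); rewrite /N; case: ifPn => _.
    by move=> + _; apply; rewrite /U/= in_itv/= ltW.
  by move=> _; apply; rewrite /U/= in_itv/=; apply/negP; rewrite -ltNge.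
(* Positive total mass guarantees that some point avoids all the null sets. *)
have ae_proper := ae_properfilter_algebraOfSetsType mu_gt0.
have [s as_] := @filter_ex _ _ ae_proper _ ae_avoid.
exists s => i; apply: filterS ae_avoid => x ax.
by apply/eqP; rewrite eq_le !le_avoid.
Qed.

Lemma integral_ae_cst (f : S -> R) (c : R) :
  measurable_fun setT f -> {ae mu, forall x, f x = c} ->
  mu.-integrable setT (EFin \o f) /\
  (\int[mu]_x f x = c * fine (mu setT))%R.
Proof.
move=> mf fc; have mEf : measurable_fun setT (EFin \o f).
  exact/measurable_EFinP.
split.
  apply/integrableP; split => //.
  rewrite (ae_eq_integral (cst `|c%:E|))//.
  - rewrite integral_cst//; apply: lte_mul_pinfty => //.
    by rewrite ltey_eq fin_num_measure.
  - exact: measurableT_comp.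
  - by apply: filterS fc => x /= -> _.
rewrite /Rintegral (ae_eq_integral (cst c%:E))//.
- by rewrite integral_cst// fineM// fin_num_measure.
- by apply: filterS fc => x /= -> _.
Qed.

End ZeroOneMeasure.

(** * Truncations and finite partitions *)

Section Truncation.
Context {d : measure_display} {S : measurableType d} {R : realType}.
Local Notation M := {finite_measure set S -> \bar R}.

(** [mu] is the sum of its truncations to [A] and to the complement, so the integral of the absolute
    value of [f] against the first is at most that against [mu]. *)
Lemma integrable_mrestr (mu : M) (A : set S) (mA : measurable A) (f : S -> R) :
  measurable_fun setT f -> mu.-integrable setT (EFin \o f) ->
  (mrestr mu mA : M).-integrable setT (EFin \o f).
Proof.
move=> mf fi; have mEf : measurable_fun setT (EFin \o f).
  exact/measurable_EFinP.
apply/integrableP; split=> //.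
pose m (b : bool) : M := 
    if b then mrestr mu mA : M else mrestr mu (measurableC mA) : M.
have muE : is_comb [:: true; false] (cst 1%R) m mu.
  move=> B mB; rewrite !big_cons big_nil adde0 /= !mul1e /mrestr.
  by rewrite (measureDI mu mB mA) addeC setDE.
have /integrableP[_] := fi; apply: le_lt_trans.
rewrite (ge0_integral_comb _ _ _ muE)//; last exact: measurableT_comp.
rewrite !big_cons big_nil adde0 /= !mul1e leeDl//.
exact: integral_ge0.
Qed.

Lemma bigcup_ord_measurable m (A : 'I_m -> set S) :
  (forall i, measurable (A i)) -> measurable (\bigcup_i A i).
Proof.
by move=> mA; apply: fin_bigcup_measurable => //; exact: finite_finset.
Qed.

Lemma measure_partition (mu : M) m (A : 'I_m -> set S) (B : set S) :
  (forall i, measurable (A i)) -> measurable B -> trivIset setT A ->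
  mu B = mu (B `&` ~` \bigcup_i A i) + \sum_(i < m) mu (B `&` A i).
Proof.
move=> mA mB tA; rewrite (measureDI mu mB (bigcup_ord_measurable mA)) setDE.
congr (_ + _).
rewrite setI_bigcupr measure_fin_bigcup//.
- rewrite (fsbigE (index_enum 'I_m)) => [||//|i _]; last first.
  + by rewrite mem_index_enum.
  + exact: index_enum_uniq.
  by apply: eq_bigl => i; rewrite in_setT.
- exact: finite_finset.
- exact: trivIset_setIl.
- by move=> i _; exact: measurableI.
Qed.

End Truncation.

(** * Atomic structure of the extreme points of a moment set *)

Section ExtremePoints.
Context {d : measure_display} {S : measurableType d} {R : realType}.
Local Notation M := {finite_measure set S -> \bar R}.
Variables (k : nat) (f : 'I_k -> S -> R) (C : set 'rV[R]_k) (L : set M).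
Hypothesis mf : forall j, measurable_fun setT (f j).
Hypotheses (Lcone : convex_cone L) (Ltrunc : truncation_closed L).
Variable mu : M.
Hypothesis mu_ex : extreme_points (L `&` moment_set f C) mu.

(* If [c] is a linear relation between the moment vectors, then rescaling [mu]
   by [1 +/- c i / K] on each [A i] changes no moment and writes [mu] as the
   midpoint of two measures of [L]; extremality makes these equal. *)
Lemma extreme_free_truncations m (A : 'I_m -> set S)
    (mA : forall i, measurable (A i)) :
  trivIset setT A -> (forall i, 0 < mu (A i)) ->
  free [tuple (\row_j \int[mrestr mu (mA i)]_x f j x)%R | i < m].
Proof.
case: mu_ex => -[Lmu [fi Cmu]] ext tA A_gt0; apply/freeP => c c0.
(* The index [None] stands for the part outside all [A i], which is never rescaled. *)
pose B o := if o is Some i then A i else ~` \bigcup_i A i.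
have mB o : measurable (B o).
  case: o => [i|]; first exact: mA.
  exact/measurableC/bigcup_ord_measurable.
pose nu o : M := mrestr mu (mB o).
pose r := None :: [seq Some i | i <- index_enum 'I_m].
(* [K] dominates every coefficient, which keeps the rescaling factors nonnegative; the summand 1
   makes it positive even if [c] vanishes. *)
pose K := (1 + \sum_i `|c i|)%R.
have K_gt0 : (0 < K)%R by rewrite ltr_pwDl// sumr_ge0.
have cK i : (`|c i / K| <= 1)%R.
  rewrite normrM normfV (gtr0_norm K_gt0) ler_pdivrMr// mul1r /K.
  by rewrite (bigD1 i)//= addrCA lerDl addr_ge0// sumr_ge0.
(* The values 1 and -1 of [s] give the two perturbations, and 0 gives [mu] itself. *)
pose b (s : R) o := (if o is Some i then 1 + s * (c i / K) else 1)%R.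
have b_ge0 s : (`|s| <= 1)%R -> forall o, (0 <= b s o)%R.
  move=> s1 [i|//]; rewrite /b -lerBlDl sub0r.
  have : (`|s * (c i / K)| <= 1)%R by rewrite normrM mulr_ile1.
  by rewrite ler_norml => /andP[].
have sum_b (s : R) (F : option 'I_m -> R) : (\sum_(o <- r) b s o * F o =
    \sum_(o <- r) F o + s * \sum_i c i / K * F (Some i))%R.
  rewrite !big_cons !big_map mul1r -addrA; congr (_ + _)%R.
  by rewrite mulr_sumr -big_split; apply: eq_bigr => i _ /=; ring.
have muE : is_comb r (b 0%R) nu mu.
  move=> U mU; rewrite (measure_partition mu mA mU tA) big_cons big_map mul1e.
  by congr (_ + _); apply: eq_bigr => i _; rewrite /b mul0r addr0 mul1e.
have nu_fi o j : (nu o).-integrable setT (EFin \o f j).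
  exact: integrable_mrestr.
have perturb s : (`|s| <= 1)%R ->
    exists2 rho : M, is_comb r (b s) nu rho & (L `&` moment_set f C) rho.
  move=> s1; have [rho rhoE] := comb_exists nu (b_ge0 _ s1) r.
  exists rho => //; split; last split.
  - apply: convex_cone_comb rhoE => //; first exact: b_ge0.
      by exists mu.
    move=> o; apply: (Ltrunc (A := B o) Lmu) => // U mU.
    by rewrite setIC.
  - move=> j; apply: (integral_comb (b_ge0 _ s1) (mf j) _ rhoE).1.
    by move=> o; exact: nu_fi.
  - rewrite (_ : (\row__ _)%R = (\row_j \int[mu]_x f j x)%R)//.
    apply/rowP => j; rewrite !mxE {1 2}/Rintegral.
    have b0_ge0 : forall o, (0 <= b 0 o)%R by apply: b_ge0; rewrite normr0.
    rewrite (integral_comb (b_ge0 _ s1) (mf j) _ rhoE).2//.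
    rewrite (integral_comb b0_ge0 (mf j) _ muE).2//.
    rewrite /fine !(sum_b _ (fun o => \int[nu o]_x f j x)%R).
    (* The part of the moments that is linear in [s] is the relation [c0] divided by [K]. *)
    suff -> : (\sum_i c i / K * \int[nu (Some i)]_x f j x = 0)%R.
      by rewrite !mulr0.
    have /(congr1 (fun v : 'rV_k => v 0%R j)) := c0.
    rewrite summxE mxE => /(congr1 ( *%R K^-1)); rewrite mulr0.
    apply: etrans; rewrite mulr_sumr; apply: eq_bigr => i _.
    by rewrite -tnth_nth tnth_mktuple !mxE; ring.
have [|rho1 rho1E Krho1] := perturb 1%R; first by rewrite normr1.
have [|rho2 rho2E Krho2] := perturb (-1)%R; first by rewrite normrN1.
have rhoE : same_measure rho1 rho2.
  apply: (ext 2^-1%R) => //; first by lra.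
  move=> U mU; rewrite (comb_fine rho1E mU) (comb_fine rho2E mU).
  rewrite (comb_fine muE mU) !sum_b -!EFinM -EFinD; congr EFin.
  by field.
move=> i.
(* On [A i] only the [i]-th rescaling is visible, so equality of [rho1] and [rho2] there forces
   [c i] to vanish. *)
have sumE : (\sum_i' c i' / K * fine (nu (Some i') (A i)) =
    c i / K * fine (mu (A i)))%R.
  rewrite (bigD1 i)//= /mrestr setIid big1 ?addr0// => i' i'i.
  rewrite (_ : A i `&` A i' = set0) ?measure0 ?mulr0//.
  by rewrite setIC; move/trivIsetP: tA; apply.
have muAi : (0 < fine (mu (A i)))%R.
  by rewrite fine_gt0// A_gt0/= ltey_eq fin_num_measure.
have := rhoE _ (mA i).
rewrite (comb_fine rho1E (mA i)) (comb_fine rho2E (mA i)) !sum_b !sumE.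
move=> -[] /addrI eqN.
have : (c i / K * fine (mu (A i)) = 0)%R by lra.
move/eqP; rewrite !mulf_eq0 invr_eq0 (gt_eqF K_gt0) (gt_eqF muAi) !orbF.
by move/eqP.
Qed.

Let disjoint_positive m := exists A : 'I_m -> set S,
  [/\ forall i, measurable (A i), trivIset setT A & forall i, 0 < mu (A i)].

(** The moment vectors of the truncations are free in a space of dimension [k]. *)
Let disjoint_positive_leq m : disjoint_positive m -> (m <= k)%N.
Proof.
move=> [A [mA tA A_gt0]]; have := extreme_free_truncations mA tA A_gt0.
rewrite /free => /eqP; rewrite size_tuple => <-.
by rewrite (leq_trans (dimvS (subvf _)))// dimvf dim_matrix mul1r.
Qed.

(** Contradicts maximality of [m]: [X] will be either the uncovered rest or a piece split off from
    one of the sets. *)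
Let disjoint_positive_ext m (A : 'I_m -> set S) (X : set S) :
  (forall i, measurable (A i)) -> trivIset setT A ->
  (forall i, 0 < mu (A i)) ->
  measurable X -> (forall i, A i `&` X = set0) -> 0 < mu X ->
  disjoint_positive m.+1.
Proof.
move=> mA tA A_gt0 mX AX X_gt0.
exists (fun i => if unlift ord0 i is Some j then A j else X); split.
- by move=> i; case: unliftP.
- apply/trivIsetP => i j _ _.
  case: (unliftP ord0 i) => [i' ->|->]; case: (unliftP ord0 j) => [j' ->|->].
  + by rewrite (inj_eq lift_inj) => ij; move/trivIsetP: tA; apply.
  + by move=> _; exact: AX.
  + by move=> _; rewrite setIC; exact: AX.
  + by rewrite eqxx.
- by move=> i; case: unliftP.
Qed.

Lemma extreme_atoms : exists m (A : 'I_m -> set S),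
  [/\ forall i, measurable (A i), trivIset setT A, forall i, 0 < mu (A i),
      mu (~` \bigcup_i A i) = 0 &
      forall i B, measurable B -> mu (B `&` A i) = 0 \/ mu (~` B `&` A i) = 0].
Proof.
(* The empty family starts the maximisation. *)
have dp0 : exists m, `[< disjoint_positive m >].
  exists 0%N; apply/asboolP; exists (fun=> set0).
  by split => [[]//|//|[]//]; apply/trivIsetP => -[].
have dp_le m : `[< disjoint_positive m >] -> (m <= k)%N.
  by move=> /asboolP; exact: disjoint_positive_leq.
case: (ex_maxnP dp0 dp_le) => m /asboolP[A [mA tA A_gt0]] maxm.
have not_ext : ~ disjoint_positive m.+1.
  by move=> /asboolP/maxm; rewrite ltnn.
have eq0 X : measurable X -> ~ 0 < mu X -> mu X = 0.
  by move=> mX /negP; rewrite lt_def measure_ge0 andbT negbK => /eqP.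
exists m, A; split => //.
- have mU : measurable (~` \bigcup_i A i).
    exact/measurableC/bigcup_ord_measurable.
  apply: eq0 => // U_gt0; apply: not_ext.
  apply: (disjoint_positive_ext mA tA A_gt0 mU _ U_gt0) => i.
  apply/disjoints_subset => x Aix; rewrite setCK.
  by exists i.
- move=> i B mB; have mBA := measurableI _ _ mB (mA i).
  have mCBA := measurableI _ _ (measurableC mB) (mA i).
  have [B_gt0|/(eq0 _ mBA)] := pselect (0 < mu (B `&` A i)); last by left.
  right; apply: eq0 => // CB_gt0; apply: not_ext.
  (* Shrinking [A i] to its part in [B] frees its part outside [B] to serve as an additional set. *)
  pose A' j := if j == i then B `&` A i else A j.
  have A'A j : A' j `<=` A j.
    by rewrite /A'; case: eqP => [->|_] x // [].
  apply: (@disjoint_positive_ext m A' _ _ _ _ mCBA _ CB_gt0).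
  + by move=> j; rewrite /A'; case: ifP.
  + apply/trivIsetP => j1 j2 _ _ j12; apply/disjoints_subset.
    apply: subset_trans (A'A j1) _ => x Aj1 /A'A Aj2.
    by move/trivIsetP: tA => /(_ j1 j2 I I j12); apply/eqP/set0P; exists x.
  + by move=> j; rewrite /A'; case: ifP.
  + move=> j; apply/disjoints_subset => x A'x [nBx Aix].
    have [ji|ji] := eqVneq j i.
      by move: A'x; rewrite /A' ji eqxx => -[].
    move/trivIsetP: tA => /(_ j i I I ji); apply/eqP/set0P; exists x.
    by split => //; exact: A'A.
Qed.

Lemma extreme_quadrature (g : S -> R) : measurable_fun setT g ->
  exists nu : M, [/\ Delta_f f nu, moment_set f C nu &
    \int[mu]_x (g x)%:E = \int[nu]_x (g x)%:E].
Proof.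
move=> mg; have [m [A [mA tA A_gt0 rest0 mu01]]] := extreme_atoms.
(* Adjoining [g] to the [f j] as the index [None] yields common points [s i] for all of them. *)
pose h (o : option 'I_k) := if o is Some j then f j else g.
have mh o : measurable_fun setT (h o) by case: o => [j|]; [exact: mf|].
pose muA i : M := mrestr mu (mA i).
have /choice[s hs] : forall i, exists s, forall o,
    {ae muA i, forall x, h o x = h o s}.
  move=> i; apply: zero_one_ae_cst => //=; first exact: mu01.
  by rewrite /mrestr setTI.
pose a i := fine (mu (A i)).
have a_gt0 i : (0 < a i)%R.
  by rewrite fine_gt0// A_gt0/= ltey_eq fin_num_measure.
have muA_h i o : (muA i).-integrable setT (EFin \o h o) /\
    (\int[muA i]_x h o x = h o (s i) * a i)%R.
  have [? ->] := integral_ae_cst (mh o) (hs i o).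
  by rewrite /= /mrestr setTI.
have muE : is_comb (index_enum 'I_m) (cst 1%R) muA mu.
  move=> B mB; rewrite (measure_partition mu mA mB tA).
  rewrite (_ : mu (_ `&` ~` _) = 0) ?add0e; last first.
    have mU : measurable (~` \bigcup_i A i).
      exact/measurableC/bigcup_ord_measurable.
    apply/eqP; rewrite eq_le measure_ge0 andbT -rest0.
    by apply: le_measure; rewrite ?inE; [exact: measurableI|exact: mU|].
  by apply: eq_bigr => i _; rewrite mul1e.
pose ds i : M := \d_(s i).
have ds_h i o : (ds i).-integrable setT (EFin \o h o) /\
    (\int[ds i]_x h o x = h o (s i))%R.
  have mEh : measurable_fun setT (EFin \o h o) by exact/measurable_EFinP.
  split.
    apply/integrableP; split => //.
    rewrite integral_dirac// ?diracT ?mul1e ?ltry//.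
    exact: measurableT_comp.
  by rewrite /Rintegral integral_dirac// diracT mul1e.
have a_ge0 i : (0 <= a i)%R by exact: ltW.
have [nu nuE] := comb_exists ds a_ge0 (index_enum 'I_m).
have mu_nu o : nu.-integrable setT (EFin \o h o) /\
    \int[mu]_x (h o x)%:E = \int[nu]_x (h o x)%:E.
  have [nui ->] := integral_comb a_ge0 (mh o) (fun i => (ds_h i o).1) nuE.
  split => //; rewrite (integral_comb _ (mh o) _ muE).2//; last first.
    by move=> i; exact: (muA_h i o).1.
  congr EFin; apply: eq_bigr => i _.
  by rewrite (muA_h i o).2 (ds_h i o).2 mul1r mulrC.
have [[_ [_ Cmu]] _] := mu_ex.
exists nu; split; last exact: (mu_nu None).2.
- exists m, a, s; split => //.
    by apply: disjoint_positive_leq; exists A.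
  (* The moment vector of the [i]-th truncation is [a i] times the value of [f] at [s i], so a
     relation [c] among these values becomes a relation with coefficients [c i / a i] among the
     moment vectors. *)
  have /freeP free_muA := extreme_free_truncations mA tA A_gt0.
  apply/freeP => c c0 i.
  suff /(_ i)/eqP : forall i, (c i / a i = 0)%R.
    by rewrite mulf_eq0 invr_eq0 (gt_eqF (a_gt0 i)) orbF => /eqP.
  apply: free_muA; apply: etrans c0; apply: eq_bigr => j _.
  rewrite -!tnth_nth !tnth_mktuple; apply/rowP => l; rewrite !mxE.
  have := (muA_h j (Some l)).2; rewrite /h => ->.
  by field; rewrite gt_eqF.
- split; first by move=> j; exact: (mu_nu (Some j)).1.
  rewrite (_ : (\row__ _)%R = (\row_j \int[mu]_x f j x)%R)//.
  apply/rowP => j; rewrite !mxE /Rintegral.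
  by have [_] := mu_nu (Some j); rewrite /h => ->.
Qed.

End ExtremePoints.

(** * Discrete measures and the comparison of suprema *)

Lemma Delta_f_sub_Delta (R : realType) (d : measure_display)
    (S : measurableType d) (k : nat) (f : 'I_k -> S -> R) :
  Delta_f f `<=` Delta k.
Proof.
move=> mu [m [a [s [mk a_gt0 _ muE]]]].
(* The family is padded to length [k] with zero weights at an arbitrary point; indexing by [nat]
   lets both sums range over the same terms. *)
pose a' (n : nat) := if insub n is Some i then a i else 0%R.
pose s' (n : nat) := if insub n is Some i then s i else point.
exists (fun i => a' i), (fun i => s' i); split.
  by move=> i; rewrite /a'; case: insubP => // j _ _; exact: ltW.
move=> A mA; rewrite muE//.
pose F n := (a' n)%:E * \d_(s' n) A.
transitivity (\sum_(i < m) F i).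
  by apply: eq_bigr => i _; rewrite /F /a' /s' valK.
rewrite (big_ord_widen k)// [RHS](bigID (fun i : 'I_k => i < m)%N)/=.
rewrite [X in _ + X]big1 ?adde0// => i im.
by rewrite /a' insubN// mul0e.
Qed.

Theorem corollary5 (R : realType) (d : measure_display) (S : measurableType d)
  (k : nat) (hk : (1 <= k)%N)
  (f : 'I_k -> S -> R) (hf : forall j, measurable_fun setT (f j))
  (C : set 'rV[R]_k)
  (L : set {finite_measure set S -> \bar R})
  (hcone : convex_cone L) (htrunc : truncation_closed L)
  (g : S -> R) (hg : measurable_fun setT g)
  (hgint : forall mu, (L `&` moment_set f C) mu -> integral_exists mu g)
  (hsup : sup_integral g (L `&` moment_set f C) =
          sup_integral g (extreme_points (L `&` moment_set f C))) :
  [/\ sup_integral g (L `&` moment_set f C) <=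
        sup_integral g (Delta_f f `&` moment_set f C),
      Delta_f f `<=` L ->
        sup_integral g (L `&` moment_set f C) =
        sup_integral g (Delta_f f `&` (L `&` moment_set f C)),
      sup_integral g (L `&` moment_set f C) <=
        sup_integral g (Delta k `&` moment_set f C) &
      Delta k `<=` L ->
        sup_integral g (L `&` moment_set f C) =
        sup_integral g (Delta k `&` (L `&` moment_set f C))].
Proof.
(* All four claims use this bound: each [K] involved contains the measures of [Delta_f] with moments
   in [C], directly or through [Delta_f_sub_Delta]. *)
have le_Delta_f (K : set {finite_measure set S -> \bar R}) :
    Delta_f f `&` moment_set f C `<=` K ->
    sup_integral g (L `&` moment_set f C) <= sup_integral g K.
  move=> DK; rewrite hsup; apply: ge_ereal_sup => _ [mu mu_ex <-].
  have [nu [nuD nuC ->]] := extreme_quadrature hf hcone htrunc mu_ex hg.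
  by apply: ereal_sup_ubound; exists nu => //; exact: DK.
have le_sub (D : set {finite_measure set S -> \bar R}) :
    sup_integral g (D `&` (L `&` moment_set f C)) <=
    sup_integral g (L `&` moment_set f C).
  by apply: ereal_sup_le; apply: image_subset => mu [].
split.
- exact: le_Delta_f.
- move=> DL; apply/eqP; rewrite eq_le le_sub andbT le_Delta_f//.
  by move=> mu [muD muC]; split => //; split => //; exact: DL.
- apply: le_Delta_f => mu [/Delta_f_sub_Delta muD muC].
  by split.
- move=> DL; apply/eqP; rewrite eq_le le_sub andbT le_Delta_f//.
  move=> mu [/Delta_f_sub_Delta muD muC].
  by split => //; split => //; exact: DL.
Qed.
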